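(* Let $\Gamma=K_{n+1}$ be the complete graph on $n+1\ge 3$ vertices, fix any vertex as the sink $v_*$, label the remaining vertices $v_1,\dots,v_n$, and write $\sigma_i=\sigma(v_i)$ for $\sigma\in\mathbb{Z}^{\mathcal{V}'}$, where $\mathcal{V}'=\{v_1,\dots,v_n\}$. Let $\sigma\in\mathbb{Z}^{\mathcal{V}'}$. Then $\sigma$ is in the image of $L':\mathbb{Z}^{\mathcal{V}'}\to\mathbb{Z}^{\mathcal{V}'}$ if and only if $$\sigma_i-\sigma_j\equiv 0 \pmod{n+1}\qquad\text{for all } 1\le i,j\le n.$$ In particular, if $\sigma$ is uniformly large, then $\sigma$ is immutable if and only if these congruences hold.
   Context: For a finite connected multigraph $\Gamma$ without self-loops, with vertex set $\mathcal{V}$, sink $v_*$ and $\mathcal{V}'=\mathcal{V}\setminus\{v_*\}$: $d(v)$ is the degree of $v$ in $\Gamma$ (including edges to the sink). The Laplacian $L$ is the $\mathcal{V}\times\mathcal{V}$ matrix with $L_{vv}=d(v)$ and $L_{vw}=-\#(v,w)$ for $v\ne w$, where $\#(v,w)$ is the number of edges joining $v$ and $w$. The reduced Laplacian $L'$ is the $\mathcal{V}'\times\mathcal{V}'$ matrix obtained from $L$ by deleting the row and column of $v_*$. Inequalities between functions on $\mathcal{V}'$ are pointwise, and constants such as $1$ denote constant functions. An element $\sigma\in\mathbb{Z}^{\mathcal{V}'}$ is uniformly large if $\sigma\ge d-1$. Odometers: for $G\in\{\mathbb{Z},\mathbb{R}\}$ and $\sigma\in\mathbb{Z}^{\mathcal{V}'}$,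 the $G$-odometer $u_\sigma^G\in G^{\mathcal{V}'}$ is the (existing and unique) element satisfying $\sigma-L'u\le d-1$ and $u\ge 0$ which is minimal, i.e. $u_\sigma^G\le u$ for every $u\in G^{\mathcal{V}'}$ satisfying both inequalities. $\sigma$ is immutable if $u_\sigma^{\mathbb{Z}}=u_\sigma^{\mathbb{R}}$. *)

(* Defs.v *)
From HB Require Import structures.
From mathcomp Require Import all_boot all_order all_algebra.
From mathcomp Require Import reals.

Set Implicit Arguments.
Unset Strict Implicit.
Unset Printing Implicit Defensive.

Import Order.TTheory GRing.Theory Num.Theory.
Local Open Scope ring_scope.

(* [nedges v w] is the number of edges joining v and w. *)
Record multigraph (N : nat) := Multigraph {
  nedges : 'I_N -> 'I_N -> nat;
  nedges_sym : forall v w, nedges v w = nedges w v;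
  nedges_loopless : forall v, nedges v v = 0%N;
  nedges_connected :
    forall v w, connect [rel x y | (0 < nedges x y)%N] v w }.

Definition degree (N : nat) (Gamma : multigraph N) (v : 'I_N) : nat :=
  (\sum_w nedges Gamma v w)%N.

Definition laplacian (N : nat) (Gamma : multigraph N) : 'M[int]_N :=
  \matrix_(v, w) (if v == w then (degree Gamma v)%:Z
                  else - (nedges Gamma v w)%:Z).

(* Deleting the sink relabels the other vertices: the vertex with index
   i : 'I_n in the reduced graph is [lift sink i], and functions on the
   non-sink vertices are column vectors of size n. *)
Definition reduced_laplacian (n : nat) (Gamma : multigraph n.+1)
    (sink : 'I_n.+1) : 'M[int]_n :=
  row' sink (col' sink (laplacian Gamma)).

Definition uniformly_large (n : nat) (Gamma : multigraph n.+1)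
    (sink : 'I_n.+1) (sigma : 'cV[int]_n) : Prop :=
  forall i, (degree Gamma (lift sink i))%:Z - 1 <= sigma i 0.

Definition stabilizing (G : numDomainType) (n : nat) (Gamma : multigraph n.+1)
    (sink : 'I_n.+1) (sigma : 'cV[int]_n) (u : 'cV[G]_n) : Prop :=
  (forall i, (map_mx intr sigma
              - map_mx intr (reduced_laplacian Gamma sink) *m u) i 0
             <= (degree Gamma (lift sink i))%:R - 1) /\
  (forall i, 0 <= u i 0).

Definition is_odometer (G : numDomainType) (n : nat) (Gamma : multigraph n.+1)
    (sink : 'I_n.+1) (sigma : 'cV[int]_n) (u : 'cV[G]_n) : Prop :=
  stabilizing Gamma sink sigma u /\
  (forall u' : 'cV[G]_n, stabilizing Gamma sink sigma u' ->
     forall i, u i 0 <= u' i 0).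

(* A least element is unique, so this says that the integer and the real
   odometers exist and coincide. *)
Definition immutable (R : realType) (n : nat) (Gamma : multigraph n.+1)
    (sink : 'I_n.+1) (sigma : 'cV[int]_n) : Prop :=
  exists (uZ : 'cV[int]_n) (uR : 'cV[R]_n),
    [/\ is_odometer Gamma sink sigma uZ,
        is_odometer Gamma sink sigma uR
      & map_mx intr uZ = uR].

Definition complete_nedges (N : nat) (v w : 'I_N) : nat := (v != w).

Fact complete_nedges_sym N (v w : 'I_N) :
  complete_nedges v w = complete_nedges w v.
Proof. by rewrite /complete_nedges eq_sym. Qed.

Fact complete_nedges_loopless N (v : 'I_N) : complete_nedges v v = 0%N.
Proof. by rewrite /complete_nedges eqxx. Qed.

Fact complete_nedges_connected N (v w : 'I_N) :
  connect [rel x y | (0 < complete_nedges x y)%N] v w.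
Proof.
have [->|vw] := eqVneq v w; first exact: connect0.
by apply: connect1; rewrite /= /complete_nedges vw.
Qed.

Definition complete_graph (N : nat) : multigraph N :=
  Multigraph (@complete_nedges_sym N) (@complete_nedges_loopless N)
             (@complete_nedges_connected N).

(* Main.v *)
Require Import Defs.
From HB Require Import structures.
From mathcomp Require Import all_boot all_order all_algebra.
From mathcomp Require Import reals.
From mathcomp Require Import ring.

Import Order.TTheory GRing.Theory Num.Theory.
Local Open Scope ring_scope.

(** On the complete graph with [n.+1] vertices the reduced Laplacian is
    [(n.+1) I - J], with [J] the all-ones matrix.  Summing the coordinates of
    [L' u] gives [sum u] back, so [L' u = t] forces
    [n.+1 * u_i = t_i + sum t] ([complete_laplacian_solve]).  Everything follows
    from this explicit inverse.

    An integral [t] is in the image over the integers exactly when [n.+1]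
    divides every [t_i + sum t]; when all the [t_i] are congruent, this number
    is congruent to [n.+1 * t_i], hence to 0.  Conversely
    [t_i - t_j = n.+1 * (u_i - u_j)] for [t = L' u]
    ([complete_laplacian_image]).

    The inverse has nonnegative entries, so [L' x >= 0] implies [x >= 0].
    Hence, for a uniformly large [sigma], the solution of
    [L' u = sigma - (d - 1)] is nonnegative, and it lies below every
    stabilizing function: it is the odometer ([is_odometer_of_eq]).  Over the
    reals such a solution always exists, so [sigma] is immutable exactly when
    the solution is integral, that is when [sigma - (d - 1)] is in the integral
    image.  As [d] is constant, this subtraction does not affect the
    differences [sigma_i - sigma_j]. *)

Lemma is_odometer_uniq (G : numDomainType) (n : nat) (Gamma : multigraph n.+1)
    (sink : 'I_n.+1) (sigma : 'cV[int]_n) (u v : 'cV[G]_n) :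
  is_odometer Gamma sink sigma u -> is_odometer Gamma sink sigma v -> u = v.
Proof.
move=> [su minu] [sv minv]; apply/colP=> i; apply: le_anti.
by rewrite (minu v sv) (minv u su).
Qed.

(** Inverse-positivity of [L'] turns the inequality
    [L' u' >= sigma - (d - 1) = L' u] into [u' >= u]; and it makes [u]
    nonnegative because uniform largeness is [L' u >= 0]. *)
Lemma is_odometer_of_eq (G : numDomainType) (n : nat)
    (Gamma : multigraph n.+1) (sink : 'I_n.+1) (sigma : 'cV[int]_n)
    (u : 'cV[G]_n) (L := map_mx intr (reduced_laplacian Gamma sink) : 'M[G]_n) :
  (forall x : 'cV[G]_n,
     (forall i, 0 <= (L *m x) i 0) -> forall i, 0 <= x i 0) ->
  uniformly_large Gamma sink sigma ->
  (forall i, (L *m u) i 0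
             = (sigma i 0 - ((degree Gamma (lift sink i))%:Z - 1))%:~R) ->
  is_odometer Gamma sink sigma u.
Proof.
move=> Lpos large Lu; split; first split.
- by move=> i; rewrite mxE mxE mxE Lu -rmorphB /= subKr rmorphB.
- by apply: Lpos => i; rewrite Lu ler0z subr_ge0.
move=> u' [su' _] i; rewrite -subr_ge0.
have -> : u' i 0 - u i 0 = (u' - u) i 0 by rewrite !mxE.
apply: Lpos => {}i; rewrite mulmxBr [X in _ <= X]mxE [X in _ + X]mxE Lu.
have := su' i; rewrite [X in X <= _]mxE [X in X + _]mxE [X in _ + X]mxE.
by rewrite subr_ge0 lerBlDr => le_s; rewrite !rmorphB /= lerBlDl.
Qed.

Lemma degree_complete (N : nat) (v : 'I_N.+1) :
  degree (complete_graph N.+1) v = N.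
Proof.
rewrite /degree (bigD1 v) //= complete_nedges_loopless add0n.
rewrite (eq_bigr (fun=> 1%N)) => [|w wv].
  by rewrite sum1_card cardC1 card_ord.
by rewrite /complete_nedges eq_sym wv.
Qed.

Lemma complete_laplacian_mul (G : nzRingType) (n : nat) (sink : 'I_n.+1)
    (x : 'cV[G]_n) (i : 'I_n) :
  (map_mx intr (reduced_laplacian (complete_graph n.+1) sink) *m x) i 0
  = n.+1%:R * x i 0 - \sum_j x j 0.
Proof.
have entry j : (map_mx intr (reduced_laplacian (complete_graph n.+1) sink)
                : 'M[G]_n) i j = n.+1%:R * (i == j)%:R - 1.
  rewrite !mxE (inj_eq lift_inj) degree_complete /= /complete_nedges.
  rewrite (inj_eq lift_inj); case: eqP => _.
    by rewrite mulr1 -natr1 addrK pmulrn.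
  by rewrite mulr0 add0r rmorphN.
rewrite mxE (eq_bigr (fun j => n.+1%:R * ((i == j)%:R * x j 0) - x j 0)).
  rewrite sumrB -mulr_sumr (bigD1 i) //= eqxx mul1r big1 ?addr0 // => j ji.
  by rewrite eq_sym (negbTE ji) mul0r.
by move=> j _; rewrite entry mulrBl mul1r mulrA.
Qed.

(** Every column of [L'] sums to [n - (n - 1) = 1], so [L'] preserves the sum
    of the coordinates; this determines the only unknown left in
    [complete_laplacian_mul]. *)
Lemma complete_laplacian_solve (G : comNzRingType) (n : nat) (sink : 'I_n.+1)
    (x : 'cV[G]_n)
    (t := map_mx intr (reduced_laplacian (complete_graph n.+1) sink) *m x)
    (i : 'I_n) :
  n.+1%:R * x i 0 = t i 0 + \sum_j t j 0.
Proof.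
have -> : \sum_j t j 0 = \sum_j x j 0.
  under eq_bigr do rewrite complete_laplacian_mul.
  rewrite sumrB -mulr_sumr sumr_const card_ord -[X in _ - X]mulr_natl.
  by rewrite -natr1; ring.
by rewrite complete_laplacian_mul subrK.
Qed.

(** The converse of [complete_laplacian_solve], wherever [n.+1] can be
    cancelled. *)
Lemma complete_laplacian_solution (G : numDomainType) (n : nat)
    (sink : 'I_n.+1) (x t : 'cV[G]_n) :
  (forall i, n.+1%:R * x i 0 = t i 0 + \sum_j t j 0) ->
  map_mx intr (reduced_laplacian (complete_graph n.+1) sink) *m x = t.
Proof.
move=> xE; apply/colP=> i; rewrite complete_laplacian_mul xE.
suff -> : \sum_j x j 0 = \sum_j t j 0 by rewrite addrK.
apply: (@mulfI _ n.+1%:R); first by rewrite pnatr_eq0.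
rewrite mulr_sumr (eq_bigr _ (fun j _ => xE j)) big_split /=.
by rewrite sumr_const card_ord -[X in _ + X]mulr_natl -natr1; ring.
Qed.

Lemma complete_laplacian_pos (G : numDomainType) (n : nat) (sink : 'I_n.+1)
    (x : 'cV[G]_n)
    (t := map_mx intr (reduced_laplacian (complete_graph n.+1) sink) *m x) :
  (forall i, 0 <= t i 0) -> forall i, 0 <= x i 0.
Proof.
move=> t_ge0 i; rewrite -(pmulr_rge0 _ (ltr0Sn G n)).
rewrite (complete_laplacian_solve _ _ sink).
by rewrite addr_ge0 ?sumr_ge0.
Qed.

Lemma complete_laplacian_image (n : nat) (sink : 'I_n.+1) (t : 'cV[int]_n) :
  (exists u, reduced_laplacian (complete_graph n.+1) sink *m u = t) <->
  (forall i j : 'I_n, ((t i 0 - t j 0)%R = 0 %[mod n.+1%:Z])%Z).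
Proof.
have intrL : map_mx intr (reduced_laplacian (complete_graph n.+1) sink)
             = reduced_laplacian (complete_graph n.+1) sink.
  by apply/matrixP=> i j; rewrite mxE intz.
split=> [[u <-] i j | congr_t].
  apply/eqP; rewrite eqz_mod_dvd subr0 -intrL !complete_laplacian_mul.
  rewrite opprB addrA subrK -mulrBr natz.
  exact: dvdz_mulr.
have dvd_t i : (n.+1%:Z %| (t i 0 + \sum_j t j 0)%R)%Z.
  (* There are [n] summands and one more [t i 0], whence [n.+1] of them. *)
  have -> : t i 0 + \sum_j t j 0 = n.+1%:Z * t i 0 - \sum_j (t i 0 - t j 0).
    rewrite sumrB sumr_const card_ord -[X in _ - (X - _)]mulr_natl.
    by rewrite -!natz -natr1; ring.
  rewrite rpredB ?dvdz_mulr // rpred_sum // => j _.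
  by have /eqP := congr_t i j; rewrite eqz_mod_dvd subr0.
exists (\col_i ((t i 0 + \sum_j t j 0)%R %/ n.+1%:Z)%Z).
rewrite -intrL; apply: complete_laplacian_solution => i.
by rewrite mxE natz mulrC divzK.
Qed.

(** The real system [L' u = sigma - (d - 1)] is always solvable, so the real
    odometer is its solution, and it is integral exactly when the right-hand
    side is in the integral image. *)
Lemma complete_immutable_image (R : realType) (n : nat) (sink : 'I_n.+1)
    (sigma : 'cV[int]_n) :
  uniformly_large (complete_graph n.+1) sink sigma ->
  immutable R (complete_graph n.+1) sink sigma <->
  (exists u, reduced_laplacian (complete_graph n.+1) sink *m u
             = sigma - const_mx (n%:Z - 1)).
Proof.
move=> large; set L := reduced_laplacian _ _; set t := sigma - _.
have odometerP (G : numDomainType) (u : 'cV[G]_n) :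
    map_mx intr L *m u = map_mx intr t ->
    is_odometer (complete_graph n.+1) sink sigma u.
  move=> Lu; apply: is_odometer_of_eq => //.
    exact: complete_laplacian_pos.
  by move=> i; rewrite Lu degree_complete !mxE.
split=> [[uZ [uR [_ odoR uE]]] | [u Lu]].
  pose tR := map_mx intr t : 'cV[R]_n.
  pose v : 'cV[R]_n := \col_i (n.+1%:R^-1 * (tR i 0 + \sum_j tR j 0)).
  have Lv : map_mx intr L *m v = tR.
    apply: complete_laplacian_solution => i.
    by rewrite [v i 0]mxE mulVKf // pnatr_eq0.
  have LuZ : map_mx intr (L *m uZ) = tR.
    have odov := odometerP _ _ Lv.
    by rewrite map_mxM uE (is_odometer_uniq _ _ _ _ _ _ _ odoR odov).
  exists uZ; apply/colP=> i; apply: (@intr_inj R).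
  by have /colP/(_ i) := LuZ; rewrite !mxE.
have odoP (G : numDomainType) :
    is_odometer (complete_graph n.+1) sink sigma (map_mx intr u : 'cV[G]_n).
  by apply: odometerP; rewrite -map_mxM Lu.
exists u, (map_mx intr u); split=> //.
have -> : u = map_mx intr u by apply/colP=> i; rewrite mxE intz.
exact: odoP.
Qed.

Theorem theorem5p4 (R : realType) (n : nat) (hn : (2 <= n)%N)
    (sink : 'I_n.+1) (sigma : 'cV[int]_n) :
  ((exists u : 'cV[int]_n,
      reduced_laplacian (complete_graph n.+1) sink *m u = sigma) <->
   (forall i j : 'I_n,
      ((sigma i 0 - sigma j 0)%R = 0 %[mod n.+1%:Z])%Z)) /\
  (uniformly_large (complete_graph n.+1) sink sigma ->
   (immutable R (complete_graph n.+1) sink sigma <->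
    (forall i j : 'I_n,
       ((sigma i 0 - sigma j 0)%R = 0 %[mod n.+1%:Z])%Z))).
Proof.
split=> [|large]; first exact: complete_laplacian_image.
have shift i j : (sigma - const_mx (n%:Z - 1)) i 0
                 - (sigma - const_mx (n%:Z - 1)) j 0 = sigma i 0 - sigma j 0.
  by rewrite !mxE; ring.
rewrite complete_immutable_image // complete_laplacian_image.
by split=> congr_s i j; have := congr_s i j; rewrite shift.
Qed.
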